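(* Let $(x^k)_{k\in\mathbb{N}}$ be the sequence generated by the relative-error method (defined in the context) with parameter $\sigma\in[0,1)$ and stepsizes $$\alpha_k=\gamma_k\,\frac{(f+g)(x^k)-s_k-\epsilon_k}{\dfrac{\sigma^2c^2}{(1-\sigma)^2}+\|u^k+w^k\|^2},$$ where $0<\underline{\gamma}\le\gamma_k\le\overline{\gamma}<2$ for all $k$, $(s_k)_{k\in\mathbb{N}}$ is a monotone decreasing real sequence converging to some $\tilde{s}\in\mathbb{R}$ with $s_k+\epsilon_k<(f+g)(x^k)$ for every $k$, $c>0$ is a constant and $w^k\in\partial g(x^k)$ are such that $\max\{\|\overline{w}^k\|,\|w^k\|,\|u^k\|\}\le c$ for all $k$. Assume $\lim_{k\to\infty}\epsilon_k=\epsilon$ for some $\epsilon\in[0,\infty)$, and that the level set $L_{f+g}(\tilde{s}):=\{x\in C: f(x)+g(x)\le\tilde{s}\}$ is nonempty. Then: (i) $(x^k)_{k\in\mathbb{N}}$ is Fejér convergent to $L_{f+g}(\tilde{s})$; (ii) $\lim_{k\to\infty}(f+g)(x^k)=\tilde{s}+\epsilon$. If in addition $\epsilon=0$, then: (iii) $(x^k)_{k\in\mathbb{N}}$ converges weakly to some point in $L_{f+g}(\tilde{s})$.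
   Context: $\mathbb{H}$ is a real Hilbert space; $f,g:\mathbb{H}\to\,]-\infty,\infty]$ are proper closed (lower semicontinuous) convex functions with domains $\mathrm{dom}\,f=\{x: f(x)<\infty\}$ and $\mathrm{dom}\,g$ (defined likewise); $C\subseteq\mathbb{H}$ is nonempty, closed and convex; $\mathrm{dom}\,g\subseteq\mathrm{dom}\,f$ and $C\subseteq\mathrm{int}(\mathrm{dom}\,g)$. $P_C$ is the orthogonal projection onto $C$. For $\epsilon\ge0$ and a convex function $h$, $\partial_\epsilon h(x)=\{v: h(x')\ge h(x)+\langle v,x'-x\rangle-\epsilon\ \ \forall x'\in\mathbb{H}\}$ and $\partial h=\partial_0h$. A sequence $(x^k)$ is Fejér convergent to a nonempty set $S\subseteq\mathbb{H}$ if $\|x^{k+1}-x\|^2\le\|x^k-x\|^2$ for all $x\in S$ and all $k\ge0$. Relative-error method: given $\sigma\in[0,1)$, $x^0\in C$, stepsizes $\alpha_k>0$ and $(\epsilon_k)\subset[0,\infty)$, for $k=0,1,\dots$: (1) $y^k=x^k-\alpha_ku^k$ with $u^k\in\partial_{\epsilon_k}f(x^k)$; (2) compute $(\overline{x}^k,\overline{w}^k,\overline{\epsilon}_k)\in\mathbb{H}\times\mathbb{H}\times[0,\infty)$ with $\overline{w}^k\in\partial_{\overline{\epsilon}_k}g(\overline{x}^k)$ and $\|\alpha_k\overline{w}^k+\overline{x}^k-y^k\|^2+2\alpha_k\overline{\epsilon}_k\le\sigma^2\|\overline{x}^k-y^k\|^2$; (3) $x^{k+1}=P_C(y^k-\alpha_k\overline{w}^k)$.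 *)

(* Defs.v *)
From mathcomp Require Import all_boot all_order all_algebra.
From mathcomp Require Import all_classical all_reals all_analysis.
Import Order.TTheory GRing.Theory Num.Theory.
Import numFieldNormedType.Exports.

Set Implicit Arguments.
Unset Strict Implicit.
Unset Printing Implicit Defensive.

Local Open Scope classical_set_scope.
Local Open Scope ring_scope.

(* A real Hilbert space is a complete normed module [H] over [R : realType]
   together with a positive definite symmetric bilinear form
   [dot : {dot H for @idfun R}] such that [dot x x = `|x| ^+ 2]. That last
   identity, which ties the form to the norm, is not part of the type of [dot];
   it is a hypothesis wherever it is needed. *)

Section ConvexAnalysis.
Context {R : realType} {H : completeNormedModType R}.
Implicit Types (h : H -> \bar R) (C S : set H) (x : nat -> H).
Local Open Scope ereal_scope.

Definition effective_domain h : set H := [set z | h z < +oo].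

Definition proper_fun h : Prop :=
  (forall z, h z != -oo) /\ effective_domain h !=set0.

(* As [0 * +oo = 0] in [\bar R], the inequality is trivial at t = 0 and t = 1.
   It is meant for functions that do not take the value -oo. *)
Definition econvex_fun h : Prop :=
  forall (a b : H) (t : R), (0 <= t <= 1)%R ->
    h (t *: a + (1 - t) *: b)%R <= t%:E * h a + (1 - t)%:E * h b.

Definition esubdiff (dot : {dot H for @idfun R}) (e : R) h (z : H) : set H :=
  [set v | forall z', h z + (dot v (z' - z) - e)%:E <= h z'].

(* [is_proj C z p] : p = P_C(z) *)
Definition is_proj C (z p : H) : Prop :=
  C p /\ forall q, C q -> (`|z - p| <= `|z - q|)%R.

Definition level_set C h (s : R) : set H := [set z | C z /\ h z <= s%:E].

Definition fejer_convergent S x : Prop :=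
  forall z, S z -> forall k, (`|x k.+1 - z| ^+ 2 <= `|x k - z| ^+ 2)%R.

Definition weakly_cvg (dot : {dot H for @idfun R}) x (l : H) : Prop :=
  forall v, dot (x k) v @[k --> \oo] --> dot l v.

End ConvexAnalysis.

(* The bars on the trial point, its subgradient and its error are rendered by
   the suffix b. *)
Record relative_error_method (R : realType) (H : completeNormedModType R)
    (dot : {dot H for @idfun R}) (f g : H -> \bar R) (C : set H) (sigma : R)
    (alpha eps : nat -> R) (x u y xb wb : nat -> H) (epsb : nat -> R) : Prop :=
  RelativeErrorMethod {
    rem_sigma : 0 <= sigma < 1;
    rem_init : C (x 0%N);
    rem_alpha : forall k, 0 < alpha k;
    rem_eps : forall k, 0 <= eps k;
    rem_subf : forall k, esubdiff dot (eps k) f (x k) (u k);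
    rem_forward : forall k, y k = x k - alpha k *: u k;
    rem_epsb : forall k, 0 <= epsb k;
    rem_subg : forall k, esubdiff dot (epsb k) g (xb k) (wb k);
    rem_error : forall k,
      `|alpha k *: wb k + xb k - y k| ^+ 2 + 2 * alpha k * epsb k
        <= sigma ^+ 2 * `|xb k - y k| ^+ 2;
    rem_next : forall k, is_proj C (y k - alpha k *: wb k) (x k.+1) }.

(* Main.v *)
Require Import Defs.
From mathcomp Require Import all_boot all_order all_algebra.
From mathcomp Require Import all_classical all_reals all_analysis.
From mathcomp Require Import ring lra.
Import Order.TTheory GRing.Theory Num.Theory.
Import numFieldNormedType.Exports.

Local Open Scope classical_set_scope.
Local Open Scope ring_scope.

Set Implicit Arguments.
Unset Strict Implicit.
Unset Printing Implicit Defensive.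

(** Everything rests on one estimate.  Write F = f + g, w for the exact
    subgradient of g at x_k, and
      eta_k = sigma^2 c^2 / (1 - sigma)^2 + |u_k + w_k|^2.
    For every z in C with F z finite,
      |x_(k+1) - z|^2 <= |x_k - z|^2
        - 2 alpha_k (F x_k - eps_k - F z) + alpha_k^2 eta_k      ([rem_step]).
    The projection onto C only decreases the distance to z, so it suffices to
    look at the unprojected point x_k - alpha_k (u_k + wb_k).  Expanding its
    distance to z and using the three subgradient inequalities leaves a cross
    term in wb_k - w_k; completing a square turns it into
    |alpha_k wb_k + xb_k - y_k|^2, which is what the relative error criterion
    controls ([relative_error_bound]).

    Put phi_k = F x_k - s_k - eps_k > 0.  The stepsize rule says
    alpha_k eta_k = gamma_k phi_k, and eta_k is bounded, so for z in the level
    set at s_lim, where F z <= s_lim <= s_k, the estimate becomes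
      |x_(k+1) - z|^2 + kappa phi_k^2 <= |x_k - z|^2
    with a constant kappa > 0.  This gives Fejer convergence, and telescoping
    gives phi_k -> 0, that is F x_k -> s_lim + eps_lim.

    Weak convergence is Opial's argument, with weak cluster points replaced by
    the set W of points that lie in the closed convex hull of every tail of
    (x_k).  When eps_lim = 0, each sublevel set of F on C above s_lim is closed,
    convex and contains a tail, so W is contained in the level set.  For p, q in
    the level set, <x_k, q - p> converges by Fejer convergence; its limit is
    also the value at any point of W, so two points p, q of W satisfy
    <p, q - p> = <q, q - p> and W has at most one point.  Decreasing bounded
    nonempty closed convex sets in a Hilbert space have a common point
    ([nested_closed_convex_nonempty]).  Applied to the tail hulls this shows
    that W is nonempty; applied to the tail hulls cut by a half-space that
    misses the point p of W, it shows that no such half-space is visited infinitely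
    often, which is weak convergence to p. *)

(** * Inner product and closed convex sets *)

Section RealHilbert.
Context {R : realType} {H : completeNormedModType R}.
Variable dot : {dot H for @idfun R}.
Hypothesis dot_norm : forall z : H, dot z z = `|z| ^+ 2.

Lemma dotC (a b : H) : dot a b = dot b a.
Proof. by rewrite hermC expr0 mul1r. Qed.

Lemma dotDl (a b d : H) : dot (a + b) d = dot a d + dot b d.
Proof. exact: linearDl. Qed.

Lemma dotNl (a d : H) : dot (- a) d = - dot a d.
Proof. exact: linearNl. Qed.

Lemma dotZl (t : R) (a d : H) : dot (t *: a) d = t * dot a d.
Proof. exact: linearZl_LR. Qed.

Lemma dotDr (a b d : H) : dot d (a + b) = dot d a + dot d b.
Proof. exact: linearDr. Qed.

Lemma dotNr (a d : H) : dot d (- a) = - dot d a.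
Proof. exact: linearNr. Qed.

Lemma dotZr (t : R) (a d : H) : dot d (t *: a) = t * dot d a.
Proof. exact: linearZr_LR. Qed.

Definition dotE := (dotDl, dotDr, dotNl, dotNr, dotZl, dotZr).

(** Reduces an identity between vectors to one between scalars, which [ring]
    can then decide after expansion by bilinearity. *)
Lemma dot_inj (a b : H) : (forall v, dot a v = dot b v) -> a = b.
Proof.
move=> ab; apply/eqP; rewrite -subr_eq0 -normr_eq0 -sqrf_eq0 -dot_norm.
by rewrite dotDl dotNl ab subrr.
Qed.

Lemma sqnormB (a b : H) :
  `|a - b| ^+ 2 = `|a| ^+ 2 - 2 * dot a b + `|b| ^+ 2.
Proof. by rewrite -!dot_norm !dotE (dotC b a); ring. Qed.

Lemma dot_polarization (a v : H) :
  dot a v = (`|a + v| ^+ 2 - `|a - v| ^+ 2) / 4.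
Proof. by rewrite -!dot_norm !dotE (dotC v a); field. Qed.

Lemma dot_continuous (v : H) : continuous (fun z : H => dot z v).
Proof.
move=> z; rewrite (_ : (fun z => _) =
    fun z : H => (`|z + v| ^+ 2 - `|z - v| ^+ 2) / 4); last first.
  by apply/funext => a; rewrite dot_polarization.
have cn (b : H) : `|a + b| ^+ 2 @[a --> z] --> `|z + b| ^+ 2.
  have h : `|a + b| @[a --> z] --> `|z + b|.
    by apply: cvg_norm; apply: cvgD; [exact: cvg_id|exact: cvg_cst].
  by rewrite expr2; under eq_fun do rewrite expr2; exact: cvgM.
by apply: cvgM; [apply: cvgB; exact: cn|exact: cvg_cst].
Qed.

Lemma convex_setE (A : set H) :
  convex_set A <->
  forall (a b : H) (t : R), 0 <= t <= 1 -> A a -> A b ->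
    A (t *: a + (1 - t) *: b).
Proof.
split=> [cA a b t t01 Aa Ab|cA a b t].
  case/andP: t01 => t0 t1.
  have := cA a b (Itv01 t0 t1).
  by rewrite !inE /= => /(_ Aa Ab).
rewrite !inE => Aa Ab; apply: cA => //.
by apply/andP; split.
Qed.

Lemma closed_halfspace (v : H) (r : R) : closed [set z | r <= dot z v].
Proof.
apply: (@preimage_closed _ _ (fun z : H => dot z v) [set y : R | r <= y]).
- by move=> z _; exact: dot_continuous.
- exact: closed_ge.
Qed.

Lemma convex_halfspace (v : H) (r : R) : convex_set [set z | r <= dot z v].
Proof.
apply/convex_setE => a b t t01 /= ra rb; rewrite !dotE.
by nra.
Qed.

Lemma closed_cball (a : H) (r : R) : closed [set z : H | `|z - a| <= r].
Proof.
apply: (@preimage_closed _ _ (fun z : H => `|z - a|) [set y : R | y <= r]).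
- move=> z _; apply: cvg_norm; apply: cvgB; [exact: cvg_id|exact: cvg_cst].
- exact: closed_le.
Qed.

Lemma convex_cball (a : H) (r : R) : convex_set [set z : H | `|z - a| <= r].
Proof.
apply/convex_setE => p q t /andP[t0 t1] /= rp rq.
have aE : a = t *: a + (1 - t) *: a by rewrite -scalerDl addrC subrK scale1r.
rewrite {1}aE opprD addrACA -!scalerBr.
apply: (le_trans (ler_normD _ _)).
rewrite !normrZ !ger0_norm ?subr_ge0//.
by nra.
Qed.

Lemma convex_setI (A B : set H) :
  convex_set A -> convex_set B -> convex_set (A `&` B).
Proof.
move=> /convex_setE cA /convex_setE cB; apply/convex_setE.
by move=> a b t t01 [Aa Ba] [Ab Bb]; split; [exact: cA|exact: cB].
Qed.

Definition closed_convex_hull (A : set H) : set H :=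
  \bigcap_(D in [set D | [/\ closed D, convex_set D & A `<=` D]]) D.

Lemma closed_convex_hull_closed A : closed (closed_convex_hull A).
Proof. by apply: closed_bigI => D []. Qed.

Lemma closed_convex_hull_convex A : convex_set (closed_convex_hull A).
Proof.
apply/convex_setE => a b t t01 Aa Ab D hD; case: (hD) => _ /convex_setE cD _.
by apply: cD => //; [exact: Aa|exact: Ab].
Qed.

Lemma sub_closed_convex_hull A : A `<=` closed_convex_hull A.
Proof. by move=> a Aa D [_ _]; exact. Qed.

Lemma closed_convex_hull_min A D :
  closed D -> convex_set D -> A `<=` D -> closed_convex_hull A `<=` D.
Proof. by move=> clD cvD AD a; apply. Qed.

Lemma closed_convex_hull_mono A B :
  A `<=` B -> closed_convex_hull A `<=` closed_convex_hull B.
Proof.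
move=> AB; apply: closed_convex_hull_min.
- exact: closed_convex_hull_closed.
- exact: closed_convex_hull_convex.
- exact: subset_trans AB (@sub_closed_convex_hull B).
Qed.

(** * Nested closed convex sets and tail hulls *)

(** The midpoint is written as a convex combination so that it is visibly a
    member of every convex set that contains both points. *)
Lemma parallelogram (a p q : H) :
  `|p - q| ^+ 2 = 2 * `|p - a| ^+ 2 + 2 * `|q - a| ^+ 2
    - 4 * `|(2^-1 *: p + (1 - 2^-1) *: q) - a| ^+ 2.
Proof.
by rewrite -!dot_norm !dotE (dotC q p) (dotC a p) (dotC a q); field.
Qed.

(** Almost minimizers of the distance to [a] over the sets [K n] form a Cauchy
    sequence: the squared minimal distances increase to a finite limit, and the
    parallelogram identity bounds the distance of two almost minimizers by their
    excess over the squared distance of their midpoint, which still lies in the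
    larger set. *)
Lemma nested_closed_convex_nonempty (K : nat -> set H) (a : H) (r : R) :
  (forall n, closed (K n)) -> (forall n, convex_set (K n)) ->
  (forall n, K n !=set0) -> (forall n m, (n <= m)%N -> K m `<=` K n) ->
  K 0%N `<=` [set z | `|z - a| <= r] -> \bigcap_n K n !=set0.
Proof.
move=> clK cvK K0 Kdecr Kr.
pose D n := [set `|z - a| ^+ 2 | z in K n].
have D0 n : D n !=set0 by have [z Kz] := K0 n; exists (`|z - a| ^+ 2), z.
have Dlb n : has_lbound (D n) by exists 0 => _ [z _ <-]; exact: sqr_ge0.
pose d n := inf (D n).
have d_le n z : K n z -> d n <= `|z - a| ^+ 2.
  by move=> Kz; apply: ge_inf => //; exists z.
have d_ndecr : nondecreasing_seq d.
  move=> n m nm; apply: lb_le_inf => // _ [z Kz <-].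
  exact/d_le/(Kdecr n m).
have d_ub n : d n <= r ^+ 2.
  have [z Kz] := K0 n; apply: (le_trans (d_le _ _ Kz)).
  have zr := Kr _ (Kdecr 0%N n (leq0n n) _ Kz).
  by rewrite lerXn2r ?nnegrE// (le_trans _ zr).
have d_cvg : cvgn d.
  by apply: nondecreasing_is_cvgn => //; exists (r ^+ 2) => _ [n _ <-].
pose l := limn d.
have d_lim n : d n <= l by exact: nondecreasing_cvgn_le.
have /choice[p pP] n : exists z, K n z /\ `|z - a| ^+ 2 < d n + n.+1%:R^-1.
  have [||_ [z Kz <-] zd] := @inf_adherent R (D n) n.+1%:R^-1.
  - by rewrite invr_gt0.
  - by split.
  - by exists z.
have p_close n m : (n <= m)%N ->
    `|p n - p m| ^+ 2 <= 2 * (l - d n) + 4 * n.+1%:R^-1.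
  move=> nm; rewrite (parallelogram a).
  have [Kn pn] := pP n; have [Km pm] := pP m.
  have mid : d n <= `|(2^-1 *: p n + (1 - 2^-1) *: p m) - a| ^+ 2.
    apply: d_le; apply: (convex_setE (K n)).1 => //; first by lra.
    exact: Kdecr Km.
  have mn : m.+1%:R^-1 <= n.+1%:R^-1 :> R by rewrite lef_pV2 ?posrE// ler_nat.
  have dm := d_lim m.
  move: mid pn pm mn dm.
  move: (n.+1%:R^-1 : R) (m.+1%:R^-1 : R) (d n) (d m) => i j dn dm'.
  by move: (`|_| ^+ 2) (`|_| ^+ 2) (`|_| ^+ 2) => A B M; lra.
have b0 : 2 * (l - d n) + 4 * n.+1%:R^-1 @[n --> \oo] --> (0 : R).
  rewrite (_ : (0 : R) = 2 * (l - l) + 4 * 0); last first.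
    by rewrite subrr !mulr0 addr0.
  apply: cvgD; apply: cvgM;
    [exact: cvg_cst| |exact: cvg_cst|exact: cvg_harmonic].
  by apply: cvgB; [exact: cvg_cst|exact: d_cvg].
have /cauchy_cvg p_cvg : cauchy (p @ \oo).
  apply: cauchy_exP => e e0.
  have [N _ hN] := cvgr_lt _ b0 (e ^+ 2) (exprn_gt0 2 e0).
  exists (p N), N => // n /= Nn; rewrite -ball_normE /=.
  rewrite -(ltr_pXn2r (n := 2))// ?nnegrE ?normr_ge0 ?ltW//.
  by apply: (le_lt_trans (p_close _ _ Nn)); exact: hN (leqnn N).
exists (lim (p @ \oo)) => n _.
apply: (@closed_cvg _ _ (p @ \oo) _ id _ (clK n)); last exact: p_cvg.
by exists n => // m /= nm; apply: (Kdecr n m nm); case: (pP m).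
Qed.

Definition tail_hull (x : nat -> H) (n : nat) : set H :=
  closed_convex_hull [set x k | k in [set k | (n <= k)%N]].

Lemma tail_hull_decr x n m : (n <= m)%N -> tail_hull x m `<=` tail_hull x n.
Proof.
move=> nm; apply: closed_convex_hull_mono => _ [k /= mk <-].
by exists k => //=; exact: leq_trans mk.
Qed.

Lemma tail_hull_sub x (D : set H) : closed D -> convex_set D ->
  (\forall k \near \oo, D (x k)) -> \bigcap_n tail_hull x n `<=` D.
Proof.
move=> clD cvD [N _ ND] z /(_ N I).
by apply: closed_convex_hull_min => // _ [k /= Nk <-]; exact: ND.
Qed.

Lemma tail_hull_dot_ge x (v p : H) (l : R) :
  (\forall k \near \oo, l <= dot (x k) v) -> (\bigcap_n tail_hull x n) p ->
  l <= dot p v.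
Proof.
move=> lx; apply: (@tail_hull_sub x [set z | l <= dot z v] _ _ lx);
  [exact: closed_halfspace|exact: convex_halfspace].
Qed.

(** A half-space containing a tail contains its hull, and the limit is squeezed
    between two families of half-spaces with normal [v]. *)
Lemma tail_hull_dot_lim x (v p : H) (l : R) :
  dot (x k) v @[k --> \oo] --> l -> (\bigcap_n tail_hull x n) p -> dot p v = l.
Proof.
move=> xl Wp; apply/eqP; rewrite eq_le; apply/andP; split.
- apply/ler_addgt0Pr => e e0.
  have : - (l + e) <= dot p (- v).
    apply: tail_hull_dot_ge Wp.
    have /(cvgr_le _)/(_ (l + e)) := xl; rewrite ltrDl => /(_ e0).
    by apply: filterS => k /=; rewrite dotNr lerN2.
  by rewrite dotNr lerN2.
- apply/ler_addgt0Pl => e e0; rewrite addrC -lerBlDr.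
  apply: tail_hull_dot_ge Wp.
  by apply: (cvgr_ge _ xl); rewrite gtrBl.
Qed.

(** If some half-space that misses [p] were visited infinitely often, its
    intersections with the tail hulls would be nested, nonempty and bounded, and
    their common point would belong to all tail hulls without being [p]. *)
Lemma weakly_cvg_tail_hull x (p a : H) (r : R) :
  (forall k, `|x k - a| <= r) -> \bigcap_n tail_hull x n `<=` [set p] ->
  weakly_cvg dot x p.
Proof.
move=> xr Wp.
have tr n : tail_hull x n `<=` [set z | `|z - a| <= r].
  apply: closed_convex_hull_min; [exact: closed_cball|exact: convex_cball|].
  by move=> _ [k _ <-]; exact: xr.
have ub v e : 0 < e -> \forall k \near \oo, dot (x k) v < dot p v + e.
  move=> e0; apply: contrapT => notnear.
  pose K n := tail_hull x n `&` [set z | dot p v + e <= dot z v].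
  have [|||||q Kq] := @nested_closed_convex_nonempty K a r.
  - move=> n; apply: closedI;
      [exact: closed_convex_hull_closed|exact: closed_halfspace].
  - move=> n; apply: convex_setI;
      [exact: closed_convex_hull_convex|exact: convex_halfspace].
  - move=> n; apply: contrapT => K0; apply: notnear; exists n => // k /= nk.
    rewrite ltNge; apply/negP => pk; apply: K0; exists (x k); split => //.
    by apply: sub_closed_convex_hull; exists k.
  - by move=> n m nm z [tz hz]; split=> //; exact: tail_hull_decr tz.
  - by move=> z [/tr].
  have qp : q = p by apply: Wp => n nT; case: (Kq n nT).
  by have [_ /=] := Kq 0%N I; rewrite qp gerDl leNgt e0.
move=> v; apply/cvgrPdist_lt => e e0.
near=> k.
have u1 : dot (x k) v < dot p v + e by near: k; exact: ub.
have u2 : dot (x k) (- v) < dot p (- v) + e by near: k; exact: ub.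
rewrite !dotNr in u2; rewrite ltr_norml; lra.
Unshelve. all: by end_near. Qed.

Lemma fejer_dist_cvg (L : set H) x (z : H) :
  fejer_convergent L x -> L z -> cvgn (fun k => `|x k - z| ^+ 2).
Proof.
move=> fej Lz; apply: nonincreasing_is_cvgn.
- by apply/nonincreasing_seqP => k; exact: fej.
- by exists 0 => _ [k _ <-]; exact: sqr_ge0.
Qed.

(** Opial's lemma, with the intersection of the tail hulls in the role of the
    set of weak cluster points. *)
Lemma opial (L : set H) x : fejer_convergent L x -> L !=set0 ->
  \bigcap_n tail_hull x n `<=` L -> exists z, L z /\ weakly_cvg dot x z.
Proof.
move=> fej [a La] WL.
have xr k : `|x k - a| <= `|x 0%N - a|.
  rewrite -(ler_pXn2r (n := 2))// ?nnegrE//.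
  elim: k => // k IH; exact: le_trans (fej _ La k) IH.
have [p Wp] : \bigcap_n tail_hull x n !=set0.
  apply: (@nested_closed_convex_nonempty _ a `|x 0%N - a|).
  - by move=> n; exact: closed_convex_hull_closed.
  - by move=> n; exact: closed_convex_hull_convex.
  - by move=> n; exists (x n); apply: sub_closed_convex_hull; exists n => /=.
  - exact: tail_hull_decr.
  - apply: closed_convex_hull_min; [exact: closed_cball|exact: convex_cball|].
    by move=> _ [k _ <-]; exact: xr.
exists p; split; first exact: WL.
apply: (weakly_cvg_tail_hull xr) => q Wq.
(* Both distances converge, hence so does their difference, which is affine
   in [x k]; [l] is the limit of its linear part. *)
pose l := (limn (fun k => `|x k - p| ^+ 2) - limn (fun k => `|x k - q| ^+ 2)
   - `|p| ^+ 2 + `|q| ^+ 2) / 2.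
have xl : dot (x k) (q - p) @[k --> \oo] --> l.
  rewrite (_ : (fun k => _) = fun k =>
     (`|x k - p| ^+ 2 - `|x k - q| ^+ 2 - `|p| ^+ 2 + `|q| ^+ 2) / 2).
    apply: cvgM; last exact: cvg_cst.
    apply: cvgD; last exact: cvg_cst.
    apply: cvgB; last exact: cvg_cst.
    by apply: cvgB; apply: fejer_dist_cvg fej _; exact: WL.
  by apply/funext => k; rewrite !sqnormB !dotE; field.
have := tail_hull_dot_lim xl Wp.
rewrite -(tail_hull_dot_lim xl Wq) => pq.
have : `|q - p| ^+ 2 = 0.
  by move: pq; rewrite -dot_norm !dotE; lra.
by move=> /eqP; rewrite sqrf_eq0 normr_eq0 subr_eq0 => /eqP.
Qed.

End RealHilbert.

(** * Level sets of a sum of extended-valued functions *)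

Section ExtendedSums.
Context {R : realType}.
Implicit Types a b : \bar R.
Local Open Scope ereal_scope.

Lemma adde_le_fin_num a b (r : R) : a != -oo -> b != -oo -> a + b <= r%:E ->
  a \is a fin_num /\ b \is a fin_num.
Proof. by case: a => [a| |]; case: b => [b| |]. Qed.

(** The source of lower semicontinuity of a sum: a strict lower bound of the sum
    splits into strict lower bounds of the two terms, which persist nearby. *)
Lemma lt_adde_split a b (r : R) : a != -oo -> b != -oo -> r%:E < a + b ->
  exists p q : R, [/\ p%:E < a, q%:E < b & (r <= p + q)%R].
Proof.
case: a => [a| |]//; case: b => [b| |]// _ _; rewrite ?lte_fin => rab.
- exists (a - (a + b - r) / 2)%R, (b - (a + b - r) / 2)%R.
  by rewrite !lte_fin; split; lra.
- by exists (a - 1)%R, (r - a + 1)%R; rewrite lte_fin ltry; split=> //; lra.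
- by exists (r - b + 1)%R, (b - 1)%R; rewrite lte_fin ltry; split=> //; lra.
- by exists r, 0%R; rewrite !ltry addr0.
Qed.

Context {H : completeNormedModType R}.
Variables f g : H -> \bar R.
Hypotheses (fNoo : forall z, f z != -oo) (gNoo : forall z, g z != -oo).

Lemma level_set_sum_closed (C : set H) (r : R) : closed C ->
  lower_semicontinuous f -> lower_semicontinuous g ->
  closed (level_set C (fun z => f z + g z) r).
Proof.
move=> clC lf lg.
have : closed (C `&` ~` [set z | r%:E < f z + g z]).
  apply: closedI => //; apply: open_closedC; rewrite openE /= => z /=.
  move=> /(lt_adde_split (fNoo z) (gNoo z)) [p [q [pf qg rpq]]].
  have [V zV Vf] := lf z p pf; have [W zW Wg] := lg z q qg.
  apply: filterS (filterI zV zW) => y [/Vf py /Wg qy].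
  apply: (@le_lt_trans _ _ (p%:E + q%:E)); first by rewrite -EFinD lee_fin.
  exact: lteD.
congr closed; apply/seteqP; split=> z [Cz /=].
  by move/negP; rewrite -leNgt.
by move=> zr; split=> //=; apply/negP; rewrite -leNgt.
Qed.

Lemma level_set_sum_convex (C : set H) (r : R) : convex_set C ->
  econvex_fun f -> econvex_fun g ->
  convex_set (level_set C (fun z => f z + g z) r).
Proof.
move=> /convex_setE cC cf cg; apply/convex_setE => a b t t01 [Ca ra] [Cb rb].
split; first exact: cC.
apply: (le_trans (leeD (cf a b t t01) (cg a b t t01))).
have [fa ga] := adde_le_fin_num (fNoo a) (gNoo a) ra.
have [fb gb] := adde_le_fin_num (fNoo b) (gNoo b) rb.
move: ra rb; rewrite -(fineK fa) -(fineK ga) -(fineK fb) -(fineK gb).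
rewrite -!EFinM -!EFinD !lee_fin => ra rb.
by case/andP: t01 => t0 t1; nra.
Qed.

End ExtendedSums.

(** * The basic estimate *)

(** The gaps of the convergent sequence [theta] tend to 0 and dominate
    [kappa * phi k ^+ 2]. *)
Lemma descent_cvg0 (R : realType) (theta phi : nat -> R) (kappa : R) :
  0 < kappa -> (forall k, 0 <= theta k) ->
  (forall k, theta k.+1 + kappa * phi k ^+ 2 <= theta k) ->
  phi @ \oo --> (0 : R).
Proof.
move=> kappa0 theta0 step.
have theta_cvg : cvgn theta.
  apply: nonincreasing_is_cvgn; last by exists 0 => _ [k _ <-].
  apply/nonincreasing_seqP => k; apply: le_trans (step k).
  by rewrite lerDl mulr_ge0 ?sqr_ge0 ?ltW.
have gap : theta k - theta k.+1 @[k --> \oo] --> (0 : R).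
  rewrite -(subrr (limn theta)); apply: cvgB; first exact: theta_cvg.
  by rewrite (cvg_shiftS theta); exact: theta_cvg.
apply/cvgrPdist_lt => e e0.
near=> k.
have hk : theta k - theta k.+1 < kappa * e ^+ 2.
  by near: k; apply: (cvgr_lt _ gap); rewrite mulr_gt0 ?exprn_gt0.
rewrite sub0r normrN.
rewrite -(ltr_pXn2r (n := 2))// ?nnegrE ?normr_ge0 ?ltW//.
rewrite real_normK ?num_real// -(ltr_pM2l kappa0).
by apply: le_lt_trans hk; rewrite lerBrDl.
Unshelve. all: by end_near. Qed.

Section Steps.
Context {R : realType} {H : completeNormedModType R}.
Variable dot : {dot H for @idfun R}.
Hypothesis dot_norm : forall z : H, dot z z = `|z| ^+ 2.

(** Moving from [p] towards [q] by a small step cannot decrease the distance to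
    [z], so the angle at [p] is obtuse; the claim is then the law of cosines. *)
Lemma is_proj_closer (C : set H) (z p q : H) : convex_set C ->
  is_proj C z p -> C q -> `|p - q| ^+ 2 <= `|z - q| ^+ 2.
Proof.
move=> /convex_setE cC [Cp pmin] Cq.
have obtuse : dot (z - p) (q - p) <= 0.
  rewrite leNgt; apply/negP => a0.
  set a := dot _ _ in a0; set b := `|q - p| ^+ 2.
  have b0 : 0 <= b by exact: sqr_ge0.
  (* Optimality of [p] against the step [t] gives 2 a <= t b, and this [t] has
     t b < a. *)
  pose t := a / (a + b).
  have ab0 : 0 < a + b by lra.
  have t0 : 0 < t by rewrite divr_gt0.
  have t1 : t <= 1 by rewrite ler_pdivrMr// mul1r lerDl.
  have tab : t * (a + b) = a by rewrite divfK ?gt_eqF.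
  have t01 : 0 <= t <= 1 by rewrite (ltW t0) t1.
  have := pmin _ (cC q p t t01 Cq Cp).
  rewrite -(ler_pXn2r (n := 2))// ?nnegrE//.
  rewrite (_ : z - (_ + _) = (z - p) - t *: (q - p)); last first.
    by apply: (dot_inj dot_norm) => v; rewrite !(dotE dot); ring.
  rewrite (sqnormB dot_norm (z - p)) normrZ exprMn (ger0_norm (ltW t0)).
  rewrite (dotZr dot) -/a -/b.
  nra.
have := sqnormB dot_norm (z - p) (q - p).
rewrite opprB addrA subrK (distrC p q).
by have := sqr_ge0 `|z - p|; lra.
Qed.

(** With e = alpha wb + xb - y, so that xb - x = e - alpha (wb + u), the
    left-hand side equals
      alpha^2 |u + w|^2 - |e - alpha (wb - w)|^2 + |e|^2 + 2 alpha epsb.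
    The error criterion bounds the last two terms by sigma^2 |xb - y|^2, and
    through |e| <= sigma |xb - y| it also gives
    |xb - y| <= alpha |wb| / (1 - sigma). *)
Lemma relative_error_bound (sigma alpha epsb c : R) (x u w y xb wb : H) :
  0 <= sigma < 1 -> 0 < alpha -> y = x - alpha *: u -> 0 <= epsb ->
  `|wb| <= c ->
  `|alpha *: wb + xb - y| ^+ 2 + 2 * alpha * epsb
    <= sigma ^+ 2 * `|xb - y| ^+ 2 ->
  2 * alpha * dot (wb - w) (xb - x) + 2 * alpha * epsb
    + alpha ^+ 2 * `|u + wb| ^+ 2
  <= alpha ^+ 2 * (sigma ^+ 2 * c ^+ 2 / (1 - sigma) ^+ 2 + `|u + w| ^+ 2).
Proof.
move=> /andP[s0 s1] a0 yE eb0 wbc crit.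
set e := alpha *: wb + xb - y in crit.
have xbE : xb - x = e - alpha *: (wb + u).
  by rewrite /e yE; apply: (dot_inj dot_norm) => v; rewrite !(dotE dot); ring.
have xby : `|xb - y| <= alpha * c / (1 - sigma).
  have e_le : `|e| <= sigma * `|xb - y|.
    rewrite -(ler_pXn2r (n := 2))// ?nnegrE ?mulr_ge0// exprMn.
    by apply: le_trans crit; rewrite lerDl !mulr_ge0// ltW.
  rewrite ler_pdivlMr ?subr_gt0//.
  have : `|xb - y| <= `|e| + alpha * `|wb|.
    rewrite -(ger0_norm (ltW a0)) -normrZ.
    rewrite (_ : xb - y = e - alpha *: wb) ?ler_normB//.
    by rewrite /e; apply: (dot_inj dot_norm) => v; rewrite !(dotE dot); ring.
  have : alpha * `|wb| <= alpha * c by rewrite ler_pM2l.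
  by nra.
have crit' : `|e| ^+ 2 + 2 * alpha * epsb <=
    alpha ^+ 2 * (sigma ^+ 2 * c ^+ 2 / (1 - sigma) ^+ 2).
  apply: (le_trans crit).
  rewrite (_ : alpha ^+ 2 * _ = sigma ^+ 2 * (alpha * c / (1 - sigma)) ^+ 2).
    rewrite ler_wpM2l ?sqr_ge0// lerXn2r ?nnegrE//.
    exact: le_trans xby.
  by field; rewrite subr_eq0 gt_eqF.
have := sqr_ge0 `|e - alpha *: (wb - w)|.
rewrite mulrDr.
move: crit'; rewrite xbE; clearbody e; rewrite -!dot_norm !(dotE dot).
rewrite (dotC dot u w) (dotC dot wb w) (dotC dot u wb) (dotC dot e wb)
  (dotC dot e w).
move: (_ / _) => A.
lra.
Qed.

Lemma esubdiff_fin_num e (h : H -> \bar R) (z v : H) :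
  proper_fun h -> esubdiff dot e h z v -> h z \is a fin_num.
Proof.
move=> [hNoo [z' hz']] /(_ z'); rewrite fin_numE hNoo /=.
apply: contraPneq => ->; rewrite addye//; apply/negP; rewrite -ltNge.
exact: hz'.
Qed.

Lemma esubdiff_fine e (h : H -> \bar R) (z v z' : H) :
  h z \is a fin_num -> h z' \is a fin_num -> esubdiff dot e h z v ->
  fine (h z) + (dot v (z' - z) - e) <= fine (h z').
Proof.
by move=> hz hz' /(_ z'); rewrite -(fineK hz) -(fineK hz') -EFinD lee_fin.
Qed.

Variables (f g : H -> \bar R) (C : set H) (sigma : R) (alpha eps : nat -> R).
Variables (x u y xb wb : nat -> H) (epsb : nat -> R).
Hypothesis x_method :
  relative_error_method dot f g C sigma alpha eps x u y xb wb epsb.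

Lemma rem_in_C k : C (x k).
Proof.
case: k => [|k]; first exact: rem_init x_method.
by have [] := rem_next x_method k.
Qed.

(** Chains the three subgradient inequalities: that of f from x_k to z, that of
    g from the trial point to z, and that of g from x_k to the trial point. *)
Lemma rem_step (c : R) (w z : H) k :
  convex_set C -> proper_fun f -> proper_fun g ->
  esubdiff dot 0 g (x k) w -> `|wb k| <= c ->
  C z -> f z \is a fin_num -> g z \is a fin_num ->
  `|x k.+1 - z| ^+ 2 <= `|x k - z| ^+ 2
    - 2 * alpha k * (fine (f (x k) + g (x k))%E - eps k - fine (f z + g z)%E)
    + alpha k ^+ 2 * (sigma ^+ 2 * c ^+ 2 / (1 - sigma) ^+ 2 + `|u k + w| ^+ 2).
Proof.
move=> cC fp gp wk wbc Cz fz gz.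
have a0 := rem_alpha x_method k.
apply: (le_trans (is_proj_closer cC (rem_next x_method k) Cz)).
have := relative_error_bound w (rem_sigma x_method) a0
  (rem_forward x_method k) (rem_epsb x_method k) wbc (rem_error x_method k).
have fx := esubdiff_fin_num fp (rem_subf x_method k).
have gx := esubdiff_fin_num gp wk.
have gxb := esubdiff_fin_num gp (rem_subg x_method k).
have hf := esubdiff_fine fx fz (rem_subf x_method k).
have hg := esubdiff_fine gxb gz (rem_subg x_method k).
have hw := esubdiff_fine gx gxb wk.
rewrite !fineD// (rem_forward x_method k).
have {hf hg hw} : alpha k * (fine (f (x k)) + fine (g (x k)) - eps k
    - (fine (f z) + fine (g z))) <= alpha k *
    (epsb k - dot (u k) (z - x k) - dot (wb k) (z - xb k) - dot w (xb k - x k)).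
  by rewrite ler_pM2l//; lra.
rewrite -!dot_norm !(dotE dot).
rewrite (dotC dot (u k) (x k)) (dotC dot z (x k)) (dotC dot z (u k))
  (dotC dot (wb k) (u k)) (dotC dot (wb k) (x k)) (dotC dot z (wb k)).
rewrite (dotC dot (x k) (u k)) (dotC dot (x k) (wb k)).
move: (_ / _) => A; lra.
Qed.

End Steps.

(** * Convergence of the relative-error method *)

Unset Implicit Arguments.

Theorem theorem5 (R : realType) (H : completeNormedModType R)
  (dot : {dot H for @idfun R}) (dot_norm : forall z : H, dot z z = `|z| ^+ 2)
  (f g : H -> \bar R) (C : set H)
  (f_proper : proper_fun f) (f_convex : econvex_fun f)
  (f_closed : lower_semicontinuous f)
  (g_proper : proper_fun g) (g_convex : econvex_fun g)
  (g_closed : lower_semicontinuous g)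
  (C_nonempty : C !=set0) (C_closed : closed C) (C_convex : convex_set C)
  (dom_gf : effective_domain g `<=` effective_domain f)
  (C_int : C `<=` (effective_domain g)°)
  (sigma : R) (alpha eps : nat -> R) (x u y xb wb : nat -> H)
  (epsb : nat -> R)
  (x_method :
    relative_error_method dot f g C sigma alpha eps x u y xb wb epsb)
  (gamma s : nat -> R) (gamma_lo gamma_hi s_lim c eps_lim : R)
  (w : nat -> H)
  (gamma_lo_gt0 : 0 < gamma_lo) (gamma_hi_lt2 : gamma_hi < 2)
  (gamma_bounds : forall k, gamma_lo <= gamma k <= gamma_hi)
  (s_decr : nonincreasing_seq s) (s_cvg : s @ \oo --> s_lim)
  (s_lt : forall k, ((s k + eps k)%:E < f (x k) + g (x k))%E)
  (c_gt0 : 0 < c)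
  (w_sub : forall k, esubdiff dot 0 g (x k) (w k))
  (c_bound : forall k,
    Num.max `|wb k| (Num.max `|w k| `|u k|) <= c)
  (alphaE : forall k,
    alpha k = gamma k * ((fine (f (x k) + g (x k))%E - s k - eps k)
      / (sigma ^+ 2 * c ^+ 2 / (1 - sigma) ^+ 2 + `|u k + w k| ^+ 2)))
  (eps_lim_ge0 : 0 <= eps_lim) (eps_cvg : eps @ \oo --> eps_lim)
  (L_nonempty : level_set C (fun z => f z + g z)%E s_lim !=set0) :
  [/\ fejer_convergent (level_set C (fun z => f z + g z)%E s_lim) x,
      (f (x k) + g (x k))%E @[k --> \oo] --> (s_lim + eps_lim)%:E
    & eps_lim = 0 ->
      exists z, level_set C (fun z => f z + g z)%E s_lim z
        /\ weakly_cvg dot x z].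
Proof.
have [fNoo _] := f_proper; have [gNoo _] := g_proper.
have xC := rem_in_C x_method.
have wbc k : `|wb k| <= c.
  by apply: le_trans (c_bound k); rewrite le_max lexx.
have wc k : `|w k| <= c.
  by apply: le_trans (c_bound k); rewrite !le_max lexx orbT.
have uc k : `|u k| <= c.
  by apply: le_trans (c_bound k); rewrite !le_max lexx !orbT.
have fx k : f (x k) \is a fin_num.
  exact: esubdiff_fin_num f_proper (rem_subf x_method k).
have gx k : g (x k) \is a fin_num.
  exact: esubdiff_fin_num g_proper (w_sub k).
have fgx k : (f (x k) + g (x k))%E \is a fin_num by rewrite fin_numD fx gx.
have [F FE] : exists F : nat -> R, forall k, (f (x k) + g (x k))%E = (F k)%:E.
  by exists (fun k => fine (f (x k) + g (x k))%E) => k; rewrite fineK.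
pose phi k := F k - s k - eps k.
have phi0 k : 0 < phi k.
  by have := s_lt k; rewrite FE lte_fin /phi -addrA -opprD subr_gt0.
have s_lim_le k : s_lim <= s k.
  rewrite -(cvg_lim _ s_cvg)//; apply: nonincreasing_cvgn_ge => //.
  by apply/cvg_ex; exists s_lim.
pose A := sigma ^+ 2 * c ^+ 2 / (1 - sigma) ^+ 2.
have A0 : 0 <= A.
  by apply: divr_ge0; [apply: mulr_ge0|]; exact: sqr_ge0.
pose eta k := A + `|u k + w k| ^+ 2.
(* Both [u k] and [w k] have norm at most [c]. *)
pose M := A + (2 * c) ^+ 2.
have M0 : 0 < M by rewrite ltr_wpDl// exprn_gt0// mulr_gt0.
have etaM k : eta k <= M.
  rewrite lerD2l lerXn2r ?nnegrE//; first by rewrite mulr_ge0// ltW.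
  apply: (le_trans (ler_normD _ _)).
  by have := wc k; have := uc k; lra.
have eta0 k : 0 < eta k.
  (* Were [eta k] zero, the stepsize would be a quotient by 0, hence 0. *)
  rewrite lt_neqAle addr_ge0 ?sqr_ge0// andbT eq_sym; apply/eqP => etak0.
  have := rem_alpha x_method k.
  by rewrite alphaE FE /= -/(phi k) -/A -/(eta k) etak0 invr0 !mulr0 ltxx.
have alpha_eta k : alpha k * eta k = gamma k * phi k.
  by rewrite alphaE FE /= -/(phi k) -/A -/(eta k) -mulrA divfK// gt_eqF.
pose kappa := (2 - gamma_hi) * gamma_lo / M.
have kappa0 : 0 < kappa by rewrite divr_gt0// mulr_gt0// subr_gt0.
have step z : level_set C (fun z => f z + g z)%E s_lim z ->
    forall k, `|x k.+1 - z| ^+ 2 + kappa * phi k ^+ 2 <= `|x k - z| ^+ 2.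
  move=> [Cz zs] k.
  have [fz gz] := adde_le_fin_num (fNoo z) (gNoo z) zs.
  have := rem_step dot_norm x_method C_convex f_proper g_proper (w_sub k)
    (wbc k) Cz fz gz.
  have zs' : fine (f z + g z)%E <= s k.
    apply: le_trans (s_lim_le k).
    by rewrite -lee_fin fineK// fin_numD fz gz.
  move: (fine (f z + g z)%E) zs' => G Gs.
  have sq_eta : alpha k ^+ 2 * eta k = alpha k * (gamma k * phi k).
    by rewrite expr2 -mulrA alpha_eta.
  rewrite FE /= -/A -/(eta k) sq_eta.
  have [/andP[glo ghi] a0] := (gamma_bounds k, rem_alpha x_method k).
  have aphi : gamma_lo / M * phi k <= alpha k.
    rewrite mulrAC ler_pdivrMr//.
    apply: (@le_trans _ _ (gamma k * phi k)); first by rewrite ler_pM2r.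
    by rewrite -alpha_eta ler_pM2l.
  have : 2 * alpha k * phi k <= 2 * alpha k * (F k - eps k - G).
    by rewrite ler_pM2l ?mulr_gt0// /phi; lra.
  have : kappa * phi k ^+ 2 <= (2 - gamma k) * (alpha k * phi k).
    rewrite (_ : kappa * _ = (2 - gamma_hi) * (gamma_lo / M * phi k * phi k)).
      apply: ler_pM.
      - by rewrite subr_ge0 ltW.
      - by rewrite !mulr_ge0 ?invr_ge0// ltW.
      - by rewrite lerB.
      - by rewrite ler_pM2r.
    by rewrite /kappa; ring.
  lra.
have fejer : fejer_convergent (level_set C (fun z => f z + g z)%E s_lim) x.
  move=> z Lz k; apply: le_trans (step z Lz k).
  by rewrite lerDl mulr_ge0 ?sqr_ge0 ?ltW.
have phi_cvg : phi @ \oo --> (0 : R).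
  have [z Lz] := L_nonempty.
  by apply: (descent_cvg0 kappa0 _ (step z Lz)) => k; exact: sqr_ge0.
have F_cvg : F k @[k --> \oo] --> s_lim + eps_lim.
  rewrite (_ : (fun k => _) = fun k => phi k + (s k + eps k)).
    rewrite -[s_lim + _]add0r; apply: cvgD; first exact: phi_cvg.
    exact: cvgD.
  by apply/funext => k; rewrite /phi; ring.
split=> //.
- under eq_fun do rewrite FE; apply: cvg_EFin F_cvg; exact: nearW.
- move=> eps_lim0; apply: (opial dot_norm fejer L_nonempty) => z Wz.
  have sub e : 0 < e -> level_set C (fun z => f z + g z)%E (s_lim + e) z.
    move=> e0.
    apply: (tail_hull_sub _ _ _ Wz).
    + exact: level_set_sum_closed.
    + exact: level_set_sum_convex.
    + near=> k; split; first exact: xC.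
      rewrite FE lee_fin; near: k.
      by apply: (cvgr_le _ F_cvg); rewrite eps_lim0 addr0 ltrDl.
  split; first by have [] := sub 1 ltr01.
  by apply/lee_addgt0Pr => e e0; have [] := sub e e0.
Unshelve. all: by end_near. Qed.
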